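(* Let $X,Y$ be real-valued random variables on a common probability space. For each $n\in\mathbb{N}$ let $\mathcal{T}_n^{(3)}$ be the $n\times n$ random symmetric tridiagonal Toeplitz matrix with all diagonal entries equal to $X$ and all superdiagonal and subdiagonal entries equal to $Y$, and let $\kappa_n=\sigma_{\max}(\mathcal{T}_n^{(3)})/\sigma_{\min}(\mathcal{T}_n^{(3)})$ be its condition number. Put $M=\max\{|X-2|Y||,\,|X+2|Y||\}$ and $m=\min\{|X-2|Y||,\,|X+2|Y||\}$. Then $\kappa_n$ converges in distribution, as $n\to\infty$, to $\kappa=V/W$, where $(W,V)$ is a random vector whose joint distribution is given, for all $x,y\in\mathbb{R}$, by $$\mathbb{P}(W\le x,\ V\le y)=\mathbb{P}(M\le y)-\mathbb{P}\left(x<0\le M\le y,\ -\tfrac{X}{|Y|}\in[-2,2]\right)-\mathbb{P}\left(x<m\le M\le y,\ -\tfrac{X}{|Y|}\notin[-2,2]\right).$$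
   Context: The same random variables $X,Y$ are used for every $n$. $\sigma_{\min}$ and $\sigma_{\max}$ denote the smallest and largest singular values. The quotients $\kappa_n$ and $\kappa$ are regarded as taking values in the extended half-line $[1,+\infty]$, with value $+\infty$ whenever the denominator is $0$, and convergence in distribution is meant in that space. A comma inside $\mathbb{P}(\cdot)$ means intersection of events. The event $-X/|Y|\in[-2,2]$ is read as $|X|\le 2|Y|$ and the event $-X/|Y|\notin[-2,2]$ as its complement (these agree with the literal meaning when $Y\neq0$). *)

(* Defs.v *)
From HB Require Import structures.
From mathcomp Require Import all_boot all_order all_algebra.
From mathcomp Require Import all_classical all_reals all_analysis.
From mathcomp Require Import measurable_realfun.
Set Implicit Arguments.
Unset Strict Implicit.
Unset Printing Implicit Defensive.
Import Order.TTheory GRing.Theory Num.Theory.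
Import numFieldNormedType.Exports.
Local Open Scope classical_set_scope.
Local Open Scope ring_scope.

Definition toeplitz3 (R : realType) (n : nat) (a b : R) : 'M[R]_n :=
  \matrix_(i < n, j < n)
    if i == j :> nat then a
    else if (i.+1 == j :> nat) || (j.+1 == i :> nat) then b
    else 0.

(* The singular values of A are the nonnegative square roots of the
   eigenvalues of A^T A. *)
Definition singular_values (R : realType) (n : nat) (A : 'M[R]_n) : set R :=
  [set s | 0 <= s /\ eigenvalue (A^T *m A) (s ^+ 2)].

(* For n > 0 the set of singular values is finite and nonempty, so that sup
   and inf are its largest and smallest elements; for n = 0 they are junk. *)
Definition sigma_max (R : realType) (n : nat) (A : 'M[R]_n) : R :=
  sup (singular_values A).

Definition sigma_min (R : realType) (n : nat) (A : 'M[R]_n) : R :=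
  inf (singular_values A).

Definition ext_quotient (R : realType) (v w : R) : \bar R :=
  if w == 0 then +oo%E else (v / w)%:E.

Definition condition_number (R : realType) (n : nat) (A : 'M[R]_n) : \bar R :=
  ext_quotient (sigma_max A) (sigma_min A).

(* The half-line [1, +oo], +oo included. *)
Definition ext_half_line (R : realType) : set (\bar R) :=
  [set x | (1 <= x)%E].

(* Z_ converges in distribution to Z as random elements of the space S, a
   subset of \bar R with the induced topology. Each variable is measurable and
   takes its values in S almost surely. The test functions are the bounded
   continuous functions on S; their values outside S are irrelevant, as is
   ensured by integrating over the event that the variable lies in S. The
   limit may live on another probability space. *)
Definition converges_in_distribution (R : realType) (S : set (\bar R))
    (d : measure_display) (T : measurableType d) (P : probability T R)
    (Z_ : nat -> T -> \bar R)
    (d' : measure_display) (T' : measurableType d') (P' : probability T' R)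
    (Z : T' -> \bar R) : Prop :=
  [/\ forall n, measurable_fun setT (Z_ n) /\ {ae P, forall t, S (Z_ n t)},
      measurable_fun setT Z /\ {ae P', forall t, S (Z t)} &
      forall f : \bar R -> R,
        {within S, continuous f} ->
        (exists C : R, forall x, S x -> `|f x| <= C) ->
        (\int[P]_(t in Z_ n @^-1` S) (f (Z_ n t))%:E)%E @[n --> \oo]
          --> (\int[P']_(t in Z @^-1` S) (f (Z t))%:E)%E].

Definition Mval (R : realType) (a b : R) : R :=
  Num.max `|a - 2 * `|b| | `|a + 2 * `|b| |.

Definition mval (R : realType) (a b : R) : R :=
  Num.min `|a - 2 * `|b| | `|a + 2 * `|b| |.

(* The event - X / |Y| \in [-2, 2] is encoded as |X| <= 2 |Y|, which also
   gives it a meaning where Y = 0. *)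
Definition limit_joint_law (R : realType)
    (d : measure_display) (T : measurableType d) (P : probability T R)
    (X Y : T -> R)
    (d' : measure_display) (T' : measurableType d') (P' : probability T' R)
    (W V : T' -> R) : Prop :=
  forall x y : R,
    P' [set t | W t <= x /\ V t <= y] =
    (P [set t | (Mval (X t) (Y t) <= y)%R]
     - P [set t | (x < 0 /\ 0 <= Mval (X t) (Y t) /\ Mval (X t) (Y t) <= y
                  /\ `|X t| <= 2 * `|Y t|)%R]
     - P [set t | (x < mval (X t) (Y t)
                  /\ mval (X t) (Y t) <= Mval (X t) (Y t)
                  /\ Mval (X t) (Y t) <= y
                  /\ ~ (`|X t| <= 2 * `|Y t|))%R])%E.

(* Main.v *)
Require Import Defs.
From HB Require Import structures.
From mathcomp Require Import all_boot all_order all_algebra.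
From mathcomp Require Import all_classical all_reals all_analysis.
From mathcomp Require Import measurable_realfun.
From mathcomp Require Import ring lra zify.
Set Implicit Arguments.
Unset Strict Implicit.
Unset Printing Implicit Defensive.
Import Order.TTheory GRing.Theory Num.Theory.
Import numFieldNormedType.Exports.
Local Open Scope classical_set_scope.
Local Open Scope ring_scope.

(** The matrix T with diagonal a and off-diagonals b has the sine vectors as
    eigenvectors, and its eigenvalues are the values of the symbol a + 2 b u at
    the points u = cos (k pi / (N + 1)), 1 <= k <= N, where N is the size
    ([sine_vector_eigen], [toeplitz3_eigP]). As T is symmetric, its singular
    values are the absolute values of these numbers
    ([singular_values_toeplitz3]).

    The cosines become dense in [-1, 1] as N grows, so sigma_max and sigma_min
    converge to the maximum and the minimum of |a + 2 b u| over [-1, 1]. The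
    maximum is M. The minimum is 0 if the symbol vanishes somewhere on
    [-1, 1], that is if |a| <= 2 |b|, and is attained at an end point, hence
    equal to m, otherwise. Writing W0 for this minimum, one gets
    kappa_n -> M / W0 at every point of the sample space
    ([cvg_condition_number]), not merely in law. Where M = 0 the matrix is zero
    and all quotients are +oo.

    The prescribed distribution function is that of (W0, M)
    ([limit_joint_lawP]): from the event M <= y one removes the part of it on
    which W0 > x, which is split according to whether W0 is 0 or m. This gives
    the existence of (W, V). A law on the plane is determined by its
    distribution function ([joint_law_unique]), so every admissible V / W has
    the law of M / W0, and the integrals of test functions converge by
    dominated convergence ([cvg_integral_half_line]). *)

(** * Singular values of tridiagonal Toeplitz matrices *)

(** The truncation of k at n makes k |-> grid_angle n k total on nat with the
    n + 1 angles of a matrix of size n + 1 as its range, so that the singular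
    values form the range of a sequence. *)
Definition grid_angle (R : realType) (n k : nat) : R :=
  (minn k n).+1%:R * pi / n.+2%:R.

(** The symbol of the Toeplitz matrix, in the variable u = cos theta. *)
Definition toeplitz_symbol (R : realType) (a b u : R) : R := a + 2 * b * u.

Definition sine_vector (R : realType) (n : nat) (theta : R) : 'rV[R]_n :=
  \row_j sin (j.+1%:R * theta).

Lemma sum_ord_delta (R : pzSemiRingType) (n m : nat) (g : nat -> R) :
  \sum_(i < n) g i * (i == m :> nat)%:R = if (m < n)%N then g m else 0.
Proof.
case: ltnP => mn.
  rewrite (bigD1 (Ordinal mn)) //= eqxx mulr1 big1 ?addr0 // => i.
  by rewrite -val_eqE /= => /negPf ->; rewrite mulr0.
by rewrite big1 // => i _; rewrite ltn_eqF ?mulr0 // (leq_trans (ltn_ord i)).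
Qed.

Lemma toeplitz3_tr (R : realType) (n : nat) (a b : R) :
  (toeplitz3 n a b)^T = toeplitz3 n a b.
Proof. by apply/matrixP => i j; rewrite !mxE eq_sym orbC. Qed.

(** The row equation at j is the addition formula
    sin (j theta) + sin ((j + 2) theta) = 2 cos theta sin ((j + 1) theta).
    At the two ends a neighbour is missing, which does no harm because
    sin 0 = 0 and, by hypothesis, sin ((n + 1) theta) = 0. *)
Lemma sine_vector_eigen (R : realType) (n : nat) (a b theta : R) :
  sin (n.+1%:R * theta) = 0 ->
  sine_vector n theta *m toeplitz3 n a b =
  toeplitz_symbol a b (cos theta) *: sine_vector n theta.
Proof.
move=> sin_end; apply/rowP => j; rewrite !mxE.
pose g (i : nat) := sin (i%:R * theta).
have toeplitzE (i : 'I_n) : toeplitz3 n a b i j =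
    a * (i == j :> nat)%:R + b * (i.+1 == j :> nat)%:R
    + b * (i == j.+1 :> nat)%:R.
  rewrite mxE [(j.+1 == i)]eq_sym.
  have [->|ij] := eqVneq (i : nat) j.
    by rewrite (gtn_eqF (ltnSn j)) (ltn_eqF (ltnSn j)) !(mulr0, mulr1, addr0).
  have [ij1|] := eqVneq i.+1 (j : nat).
    by rewrite -ij1 (ltn_eqF (leqW (ltnSn i))) !(mulr0, mulr1, addr0, add0r).
  by move=> _ /=; case: eqP => _; rewrite !(mulr0, mulr1, addr0, add0r).
have -> : \sum_i sine_vector n theta 0 i * toeplitz3 n a b i j =
    a * \sum_(i < n) g i.+1 * (i == j :> nat)%:R
    + b * \sum_(i < n) g i.+1 * (i.+1 == j :> nat)%:R
    + b * \sum_(i < n) g i.+1 * (i == j.+1 :> nat)%:R.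
  rewrite !big_distrr -!big_split; apply: eq_bigr => i _ /=.
  by rewrite toeplitzE mxE /g; ring.
(* The right neighbour; for the last row both sides are 0 by sin_end. *)
have -> : \sum_(i < n) g i.+1 * (i == j.+1 :> nat)%:R = g j.+2.
  rewrite (@sum_ord_delta _ _ _ (fun i => g i.+1)); case: ltnP => // nj.
  by rewrite /g; have -> : j.+2 = n.+1 by have := ltn_ord j; lia.
(* The left neighbour; for the first row both sides are 0, as sin 0 = 0. *)
have -> : \sum_(i < n) g i.+1 * (i.+1 == j :> nat)%:R = g j.
  case: j {toeplitzE} => -[|j] jn /=.
    by rewrite big1 => [|i _]; rewrite ?mulr0 // /g mul0r sin0.
  under eq_bigr do rewrite eqSS.
  by rewrite (@sum_ord_delta _ _ _ (fun i => g i.+1)) ltnW.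
rewrite (@sum_ord_delta _ _ _ (fun i => g i.+1)) ltn_ord /toeplitz_symbol.
have -> : g j.+2 = g j.+1 * cos theta + cos (j.+1%:R * theta) * sin theta.
  by rewrite /g -sinD; congr sin; rewrite -[j.+2%:R]natr1; ring.
have -> : g j = g j.+1 * cos theta - cos (j.+1%:R * theta) * sin theta.
  by rewrite /g -sinB; congr sin; rewrite -[j.+1%:R]natr1; ring.
by rewrite /g; ring.
Qed.

Lemma sin_natpi (R : realType) (k : nat) : sin (k%:R * pi) = 0 :> R.
Proof.
elim: k => [|k IH]; first by rewrite mul0r sin0.
by rewrite -natr1 mulrDl mul1r sinDpi IH oppr0.
Qed.

Lemma grid_angle_gt0_ltpi (R : realType) (n k : nat) :
  0 < grid_angle R n k < pi.
Proof.
have pi0 := pi_gt0 R; have n2 : 0 < n.+2%:R :> R by rewrite ltr0n.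
rewrite /grid_angle divr_gt0 ?mulr_gt0 ?ltr0n //=.
by rewrite ltr_pdivrMr // mulrC ltr_pM2l // ltr_nat !ltnS geq_minr.
Qed.

Lemma toeplitz3_eig (R : realType) (n k : nat) (a b : R) :
  eigenvalue (toeplitz3 n.+1 a b)
    (toeplitz_symbol a b (cos (grid_angle R n k))).
Proof.
apply/eigenvalueP; exists (sine_vector n.+1 (grid_angle R n k)).
  apply: sine_vector_eigen.
  rewrite /grid_angle mulrCA divff ?pnatr_eq0 // mulr1.
  exact: sin_natpi.
apply/eqP => /rowP /(_ ord0) /eqP; rewrite !mxE mul1r.
by rewrite gt_eqF // sin_gt0_pi // grid_angle_gt0_ltpi.
Qed.

Lemma grid_angle_inj (R : realType) (n j k : nat) : (j <= n)%N -> (k <= n)%N ->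
  cos (grid_angle R n j) = cos (grid_angle R n k) -> j = k.
Proof.
move=> jn kn /cos_inj; rewrite !in_itv /=.
have [/andP[j0 jpi] /andP[k0 kpi]] :=
  (grid_angle_gt0_ltpi R n j, grid_angle_gt0_ltpi R n k).
rewrite !ltW // => /(_ isT isT) /eqP.
rewrite /grid_angle (minn_idPl jn) (minn_idPl kn).
have pi0 : pi != 0 :> R by rewrite gt_eqF ?pi_gt0.
rewrite (inj_eq (mulIf _)) ?invr_neq0 ?pnatr_eq0 // (inj_eq (mulIf pi0)).
by rewrite eqr_nat eqSS => /eqP.
Qed.

(** For b != 0 the n + 1 eigenvalues already known are distinct, so another one
    would be one root too many for the characteristic polynomial. For b = 0
    the matrix is scalar. *)
Lemma toeplitz3_eigP (R : realType) (n : nat) (a b l : R) :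
  eigenvalue (toeplitz3 n.+1 a b) l ->
  exists k, l = toeplitz_symbol a b (cos (grid_angle R n k)).
Proof.
move=> eig_l; have [b0|b0] := eqVneq b 0.
  exists 0%N; move: eig_l; rewrite /toeplitz_symbol b0 mulr0 mul0r addr0.
  have -> : toeplitz3 n.+1 a 0 = a%:M.
    by apply/matrixP => i j; rewrite !mxE if_same -val_eqE mulrb.
  move=> /eigenvalueP[v]; rewrite mul_mx_scalar => /eqP.
  rewrite -subr_eq0 -scalerBl scaler_eq0 subr_eq0.
  by move=> /orP[/eqP -> //|/eqP ->]; rewrite eqxx.
apply: contrapT => l_new.
pose eigs :=
  [seq toeplitz_symbol a b (cos (grid_angle R n k)) | k <- iota 0 n.+1].
have eigs_uniq : uniq (l :: eigs).
  rewrite cons_uniq map_inj_in_uniq ?iota_uniq ?andbT.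
    by apply/negP => /mapP[k _ lE]; apply: l_new; exists k.
  move=> j k; rewrite !mem_iota !add0n /= !ltnS => jn kn /addrI /mulfI.
  by rewrite mulf_neq0 ?pnatr_eq0 // => /(_ isT); exact: grid_angle_inj.
have eigs_root : all (root (char_poly (toeplitz3 n.+1 a b))) (l :: eigs).
  apply/allP => x; rewrite inE -eigenvalue_root_char => /orP[/eqP -> //|].
  by move=> /mapP[k _ ->]; exact: toeplitz3_eig.
have char_neq0 : char_poly (toeplitz3 n.+1 a b) != 0.
  by rewrite -size_poly_eq0 size_char_poly.
have := max_poly_roots char_neq0 eigs_root eigs_uniq.
by rewrite size_char_poly /= size_map size_iota ltnn.
Qed.

(** Here A^T A = A^2, and A^2 - s^2 = (A - s) (A + s): an eigenvector v of A^2
    for s^2 is an eigenvector of A for s unless v (A - s) is nonzero, and then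
    the latter is an eigenvector for - s. *)
Lemma singular_valuesP (R : realType) (n : nat) (A : 'M[R]_n) (s : R) :
  A^T = A ->
  singular_values A s <-> exists2 l, eigenvalue A l & s = `|l|.
Proof.
move=> symA; rewrite /singular_values /= symA; split; last first.
  move=> [l /eigenvalueP[v vA v0] ->]; split; first exact: normr_ge0.
  apply/eigenvalueP; exists v => //.
  by rewrite mulmxA vA -scalemxAl vA scalerA real_normK ?num_real.
move=> [s0 /eigenvalueP[v vAA v0]].
have [w0|w0] := eqVneq (v *m A - s *: v) 0.
  exists s; last by rewrite ger0_norm.
  by apply/eigenvalueP; exists v => //; apply/eqP; rewrite -subr_eq0 w0.
exists (- s); last by rewrite normrN ger0_norm.
apply/eigenvalueP; exists (v *m A - s *: v) => //.
rewrite mulmxBl -mulmxA vAA -scalemxAl scalerBr scalerA.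
by rewrite mulNr -expr2 !scaleNr opprK addrC.
Qed.

Lemma singular_values_toeplitz3 (R : realType) (n : nat) (a b : R) :
  singular_values (toeplitz3 n.+1 a b) =
  range (fun k => `|toeplitz_symbol a b (cos (grid_angle R n k))|).
Proof.
apply/seteqP; split => s.
  move=> /(singular_valuesP _ (toeplitz3_tr _ _ _))[l /toeplitz3_eigP[k ->] ->].
  by exists k.
move=> [k _ <-]; apply/singular_valuesP; first exact: toeplitz3_tr.
exists (toeplitz_symbol a b (cos (grid_angle R n k))) => //.
exact: toeplitz3_eig.
Qed.

(** * Limits of the extreme singular values *)

(** The minimum of |a + 2 b u| over u in [-1, 1], the limit of sigma_min. *)
Definition Wval (R : realType) (a b : R) : R :=
  if `|a| <= 2 * `|b| then 0 else mval a b.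

Lemma toeplitz_symbol_bounds (R : realType) (a b u : R) : `|u| <= 1 ->
  Wval a b <= `|toeplitz_symbol a b u| <= Mval a b.
Proof.
move=> u1; have : `|b * u| <= `|b| by rewrite normrM ler_piMr.
rewrite /Wval /toeplitz_symbol /mval /Mval -mulrA ler_norml => /andP[].
move: (b * u) => v v1 v2; rewrite le_max.
have b0 : 0 <= `|b| by exact: normr_ge0.
apply/andP; split; last first.
  case: (ger0P (a + 2 * v)); case: (ger0P (a - 2 * `|b|));
    case: (ger0P (a + 2 * `|b|)) => *; apply/orP; lra.
case: ifPn => // ; rewrite -ltNge ge_min.
case: (ger0P (a + 2 * v)); case: (ger0P (a - 2 * `|b|));
  case: (ger0P (a + 2 * `|b|)); case: (ger0P a) => *; apply/orP; lra.
Qed.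

Lemma toeplitz_symbol_max (R : realType) (a b : R) :
  exists2 u, `|u| <= 1 & `|toeplitz_symbol a b u| = Mval a b.
Proof.
(* At u = sg b and u = - sg b the symbol takes the values a + 2 |b| and
   a - 2 |b|. *)
have sg1 : `|Num.sg b| <= 1 by rewrite normr_sg lern1 leq_b1.
have bE : b * Num.sg b = `|b| by rewrite mulrC -normrEsg.
rewrite /Mval; case: leP => _; [exists (Num.sg b) => //|exists (- Num.sg b)];
  rewrite ?normrN //.
  by rewrite /toeplitz_symbol -mulrA bE.
by rewrite /toeplitz_symbol -mulrA mulrN bE mulrN.
Qed.

Lemma toeplitz_symbol_min (R : realType) (a b : R) :
  exists2 u, `|u| <= 1 & `|toeplitz_symbol a b u| = Wval a b.
Proof.
(* At u = sg b and u = - sg b the symbol takes the values a + 2 |b| and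
   a - 2 |b|. *)
have sg1 : `|Num.sg b| <= 1 by rewrite normr_sg lern1 leq_b1.
have bE : b * Num.sg b = `|b| by rewrite mulrC -normrEsg.
rewrite /Wval; case: ifPn => [ab|_].
  have [b0|b0] := eqVneq b 0.
    exists 0; first by rewrite normr0.
    move: ab; rewrite b0 normr0 mulr0 normr_le0 /toeplitz_symbol => /eqP ->.
    by rewrite mulr0 addr0 normr0.
  have b20 : 2 * b != 0 by rewrite mulf_neq0 ?pnatr_eq0.
  exists (- (a / (2 * b))).
    rewrite normrN normf_div ler_pdivrMr ?normr_gt0 // mul1r normrM.
    by rewrite ger0_norm.
  by rewrite /toeplitz_symbol mulrN mulrC divfK // subrr normr0.
rewrite /mval; case: leP => _; [exists (- Num.sg b)|exists (Num.sg b) => //];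
  rewrite ?normrN //.
  by rewrite /toeplitz_symbol -mulrA mulrN bE mulrN.
by rewrite /toeplitz_symbol -mulrA bE.
Qed.

(** Round theta down to a multiple of the step, then go one step up; near pi the
    truncation of the index makes this the last grid point, which is still
    within one step. *)
Lemma grid_angle_near (R : realType) (theta : R) (n : nat) : 0 <= theta <= pi ->
  exists k, `|grid_angle R n k - theta| <= pi / n.+2%:R.
Proof.
move=> /andP[theta0 thetapi]; have pi0 := pi_gt0 R.
have n2 : 0 < n.+2%:R :> R by rewrite ltr0n.
pose u := theta * n.+2%:R / pi.
have u0 : 0 <= u by rewrite divr_ge0 ?pi_ge0 // mulr_ge0 // ler0n.
have un : u <= n.+2%:R by rewrite ler_pdivrMr // [leRHS]mulrC ler_pM2r.
exists (Num.truncn u); have /andP[ku uk] := truncn_itv u0.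
have -> : grid_angle R n (Num.truncn u) - theta =
    ((minn (Num.truncn u) n).+1%:R - u) * (pi / n.+2%:R).
  rewrite /grid_angle mulrBl mulrA; congr (_ - _).
  by rewrite /u mulrA divfK ?gt_eqF // mulfK ?gt_eqF.
have step0 : 0 <= pi / n.+2%:R :> R by rewrite divr_ge0 ?pi_ge0.
rewrite normrM [X in _ * X]ger0_norm // ler_piMl //.
rewrite ler_norml; move: ku uk; case: leqP => [kn|nk] ku uk.
  by rewrite -natr1 in uk *; lra.
have : n.+1%:R <= (Num.truncn u)%:R :> R by rewrite ler_nat.
by rewrite -[n.+2%:R]natr1 in un; lra.
Qed.

Lemma cvg_cos_grid (R : realType) (u : R) : `|u| <= 1 ->
  exists k : nat -> nat, cos (grid_angle R n (k n)) @[n --> \oo] --> u.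
Proof.
rewrite ler_norml => u1.
have theta_itv : 0 <= acos u <= pi by rewrite acos_ge0 // acos_lepi.
have /choice[k kP] n := grid_angle_near n theta_itv.
exists k; rewrite -[X in _ --> X](acosK _) ?in_itv //=.
apply: (cvg_comp (fun n => grid_angle R n (k n)) (@cos R));
  last exact: continuous_cos.
apply/cvgrPdist_le => e e0.
have : pi * (@harmonic R) n @[n --> \oo] --> (pi * 0 : R).
  by apply: cvgMr; exact: cvg_harmonic.
rewrite mulr0 => /cvgr0_norm_le/(_ _ e0); apply: filterS => n; apply: le_trans.
rewrite distrC (le_trans (kP n)) // (le_trans _ (ler_norm _)) //.
by rewrite ler_pM2l ?pi_gt0 // /harmonic /= lef_pV2 ?posrE ?ltr0n // ler_nat.
Qed.

(** Both limits are obtained by squeezing: one bound is the extremum over the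
    whole of [-1, 1], the other the value at grid points approaching a place
    where the extremum is attained. *)
Section singular_limits.
Context (R : realType) (a b : R).
Let sv n k : R := `|toeplitz_symbol a b (cos (grid_angle R n k))|.

Let sv_bounds n k : Wval a b <= sv n k <= Mval a b.
Proof. by apply: toeplitz_symbol_bounds; exact: cos_max. Qed.

Let sv_ubound n : ubound (singular_values (toeplitz3 n.+1 a b)) (Mval a b).
Proof.
by rewrite singular_values_toeplitz3 => _ [k _ <-]; case/andP: (sv_bounds n k).
Qed.

Let sv_lbound n : lbound (singular_values (toeplitz3 n.+1 a b)) (Wval a b).
Proof.
by rewrite singular_values_toeplitz3 => _ [k _ <-]; case/andP: (sv_bounds n k).
Qed.

Let sv_in n k : singular_values (toeplitz3 n.+1 a b) (sv n k).
Proof. by rewrite singular_values_toeplitz3; exists k. Qed.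

Lemma sigma_max_bounds n k :
  sv n k <= sigma_max (toeplitz3 n.+1 a b) <= Mval a b.
Proof.
apply/andP; split.
  apply: ub_le_sup; last exact: sv_in.
  by exists (Mval a b); exact: sv_ubound.
by apply: ge_sup; [exists (sv n 0); exact: sv_in|exact: sv_ubound].
Qed.

Lemma sigma_min_bounds n k :
  Wval a b <= sigma_min (toeplitz3 n.+1 a b) <= sv n k.
Proof.
apply/andP; split.
  by apply: lb_le_inf; [exists (sv n 0); exact: sv_in|exact: sv_lbound].
apply: ge_inf; last exact: sv_in.
by exists (Wval a b); exact: sv_lbound.
Qed.

Lemma cvg_sv_grid u : `|u| <= 1 -> exists k : nat -> nat,
  sv n (k n) @[n --> \oo] --> `|toeplitz_symbol a b u|.
Proof.
move=> /cvg_cos_grid[k cvgk]; exists k; apply: cvg_norm.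
by apply: cvgD; [exact: cvg_cst|apply: cvgMr].
Qed.

Lemma cvg_sigma_max :
  sigma_max (toeplitz3 n.+1 a b) @[n --> \oo] --> Mval a b.
Proof.
have [u /cvg_sv_grid[k cvgk] uM] := toeplitz_symbol_max a b; rewrite uM in cvgk.
apply: squeeze_cvgr cvgk (@cvg_cst _ _ _ _ _).
by apply: nearW => n; exact: sigma_max_bounds.
Qed.

Lemma cvg_sigma_min :
  sigma_min (toeplitz3 n.+1 a b) @[n --> \oo] --> Wval a b.
Proof.
have [u /cvg_sv_grid[k cvgk] uW] := toeplitz_symbol_min a b; rewrite uW in cvgk.
apply: squeeze_cvgr (@cvg_cst _ _ _ _ _) cvgk.
by apply: nearW => n; exact: sigma_min_bounds.
Qed.

Lemma Wval_ge0 : 0 <= Wval a b.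
Proof. by have [u _ <-] := toeplitz_symbol_min a b. Qed.

Lemma Wval_le_Mval : Wval a b <= Mval a b.
Proof. by have /andP[/le_trans] := sv_bounds 0 0; apply. Qed.

Lemma sigma_min_ge0 n : 0 <= sigma_min (toeplitz3 n.+1 a b).
Proof.
by rewrite (le_trans Wval_ge0) //; case/andP: (sigma_min_bounds n 0).
Qed.

Lemma sigma_min_le_max n :
  sigma_min (toeplitz3 n.+1 a b) <= sigma_max (toeplitz3 n.+1 a b).
Proof.
case/andP: (sigma_min_bounds n 0) => _ /le_trans; apply.
by case/andP: (sigma_max_bounds n 0).
Qed.

End singular_limits.

(** * Convergence of the condition numbers *)

Lemma ext_quotient_ge1 (R : realType) (v w : R) : 0 <= w <= v ->
  @ext_half_line R (ext_quotient v w).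
Proof.
move=> /andP[w0 wv]; rewrite /ext_half_line /ext_quotient /=.
case: eqVneq => [_|wn0]; first exact: leey.
by rewrite lee_fin ler_pdivlMr ?mul1r // lt_def wn0.
Qed.

(** If w = 0 the denominators tend to 0 from above while the numerators stay
    away from 0, so the quotients tend to +oo, which is also their value where
    a denominator vanishes. *)
Lemma cvg_ext_quotient (R : realType) (v_ w_ : nat -> R) (v w : R) :
  (forall n, 0 <= w_ n) -> 0 < v ->
  v_ n @[n --> \oo] --> v -> w_ n @[n --> \oo] --> w ->
  ext_quotient (v_ n) (w_ n) @[n --> \oo] --> ext_quotient v w.
Proof.
move=> w_ge0 v0 cvgv cvgw; rewrite /ext_quotient; case: eqVneq => [w0|w0].
  apply/cvgeyPge => A; pose B := `|A| + 1.
  (* Eventually v_n > v / 2 and w_n < v / (2 B), so that v_n / w_n > B. *)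
  have B0 : 0 < B by rewrite ltr_wpDl.
  have vB : 0 < v / 2 / B by rewrite !divr_gt0.
  have v2 : v / 2 < v by rewrite gtr_pMr // invf_lt1 // ltr1n.
  rewrite w0 in cvgw.
  move/cvgr_gt: cvgv => /(_ _ v2) nv; move/cvgr_lt: cvgw => /(_ _ vB) nw.
  near=> n.
  case: eqVneq => [_|wn0]; first exact: leey.
  have wn : 0 < w_ n by rewrite lt_def wn0 w_ge0.
  rewrite lee_fin ler_pdivlMr //.
  have : w_ n < v / 2 / B by near: n.
  have : v / 2 < v_ n by near: n.
  rewrite ltr_pdivlMr //= => v2n wB.
  rewrite (le_trans _ (ltW v2n)) // (le_trans _ (ltW wB)) // mulrC ler_pM2l //.
  by rewrite /B (le_trans (ler_norm A)) // lerDl.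
have : (v_ n / w_ n)%:E @[n --> \oo] --> (v / w)%:E.
  by apply/cvg_EFin; [exact: nearW|apply: cvgM => //; exact: cvgV].
apply: cvg_trans; apply: near_eq_cvg; near=> n.
suff /negPf -> : w_ n != 0 by [].
by near: n; apply: (cvgr_neq0 w cvgw w0).
Unshelve. all: by end_near. Qed.

(** If M = 0 numerators and denominators both tend to 0, but then
    0 <= sigma_min <= sigma_max <= M forces every sigma_min to be 0, and the
    sequence is constantly +oo. *)
Lemma cvg_condition_number (R : realType) (a b : R) :
  condition_number (toeplitz3 n.+1 a b) @[n --> \oo]
    --> ext_quotient (Mval a b) (Wval a b).
Proof.
have M0 : 0 <= Mval a b := le_trans (Wval_ge0 a b) (Wval_le_Mval a b).
move: M0; rewrite le_eqVlt => /predU1P[M0|M0]; last first.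
  apply: cvg_ext_quotient => //; first exact: sigma_min_ge0.
    exact: cvg_sigma_max.
  exact: cvg_sigma_min.
have W0 : Wval a b = 0.
  by apply/eqP; rewrite eq_le Wval_ge0 andbT M0 Wval_le_Mval.
rewrite [X in X @ _ --> _](_ : _ = cst (ext_quotient (Mval a b) (Wval a b))).
  exact: cvg_cst.
apply/funext => n; rewrite /condition_number /ext_quotient /= W0 eqxx.
have -> : sigma_min (toeplitz3 n.+1 a b) = 0; last by rewrite eqxx.
apply/eqP; rewrite eq_le sigma_min_ge0 andbT M0.
rewrite (le_trans (sigma_min_le_max _ _ _)) //.
by case/andP: (sigma_max_bounds a b n 0).
Qed.

(** * Measurability *)

(** The singular values form the range of a sequence of measurable functions,
    so their supremum and infimum are the first terms of the sequences of tail
    suprema and tail infima. *)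
Lemma measurable_sigma (R : realType) (d : measure_display)
    (T : measurableType d) (X Y : T -> R) (n : nat) :
  measurable_fun setT X -> measurable_fun setT Y ->
  measurable_fun setT (fun t => sigma_max (toeplitz3 n.+1 (X t) (Y t))) /\
  measurable_fun setT (fun t => sigma_min (toeplitz3 n.+1 (X t) (Y t))).
Proof.
move=> mX mY.
pose h k t := `|toeplitz_symbol (X t) (Y t) (cos (grid_angle R n k))|.
have mh k : measurable_fun setT (h k).
  apply: measurableT_comp => //; apply: measurable_funD => //.
  apply: measurable_funM => //; exact: measurable_funM.
have svE t : singular_values (toeplitz3 n.+1 (X t) (Y t)) = sdrop (h ^~ t) 0.
  rewrite singular_values_toeplitz3.
  by apply/seteqP; split => _ [k _ <-]; exists k.
have h_bounds t k : Wval (X t) (Y t) <= h k t <= Mval (X t) (Y t).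
  by apply: toeplitz_symbol_bounds; exact: cos_max.
rewrite /sigma_max /sigma_min; split; under eq_fun do rewrite svE.
  apply: (@measurable_fun_sups _ _ _ _ h 0) => // t _.
  exists (Mval (X t) (Y t)).
  by move=> _ [k _ <-]; case/andP: (h_bounds t k).
apply: (@measurable_fun_infs _ _ _ _ h 0) => // t _.
exists (Wval (X t) (Y t)).
by move=> _ [k _ <-]; case/andP: (h_bounds t k).
Qed.

Lemma measurable_invr (R : realType) : measurable_fun setT (@GRing.inv R).
Proof.
have m0 : measurable [set (0 : R)] by [].
rewrite -(setvU [set (0 : R)]); apply/measurable_funU => //.
  exact: measurableC.
split; last exact: measurable_fun_set1.
have -> : ~` [set (0 : R)] = [set x | x != 0].
  by apply/seteqP; split => x /= /eqP.
apply: open_continuous_measurable_fun; first exact: open_neq.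
by move=> x /[!inE]; exact: inv_continuous.
Qed.

Lemma measurable_ext_quotient (R : realType) (d : measure_display)
    (T : measurableType d) (V W : T -> R) :
  measurable_fun setT V -> measurable_fun setT W ->
  measurable_fun setT (fun t => ext_quotient (V t) (W t)).
Proof.
move=> mV mW; apply: measurable_fun_ifT => //; first exact: measurable_fun_eqr.
apply/measurable_EFinP; apply: measurable_funM => //.
by apply: measurableT_comp => //; exact: measurable_invr.
Qed.

Section limit_variables.
Context (R : realType) (d : measure_display) (T : measurableType d)
  (X Y : T -> R) (mX : measurable_fun setT X) (mY : measurable_fun setT Y).

Let m2Y : measurable_fun setT (fun t => 2 * `|Y t|).
Proof. by apply: measurable_funM => //; exact: measurableT_comp. Qed.

Lemma measurable_Mval : measurable_fun setT (fun t => Mval (X t) (Y t)).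
Proof.
apply: measurable_maxr; apply: measurableT_comp => //.
  exact: measurable_funB.
exact: measurable_funD.
Qed.

Lemma measurable_mval : measurable_fun setT (fun t => mval (X t) (Y t)).
Proof.
apply: measurable_minr; apply: measurableT_comp => //.
  exact: measurable_funB.
exact: measurable_funD.
Qed.

Lemma measurable_Wval : measurable_fun setT (fun t => Wval (X t) (Y t)).
Proof.
apply: measurable_fun_ifT => //; last exact: measurable_mval.
by apply: measurable_fun_ler => //; exact: measurableT_comp.
Qed.

End limit_variables.

(** * The law of the limit *)

Lemma mval_le_Mval (R : realType) (a b : R) : mval a b <= Mval a b.
Proof. by rewrite /mval /Mval ge_min !le_max lexx. Qed.

(** On the event M <= y, the condition W0 > x means x < 0 if |X| <= 2 |Y| and
    x < m otherwise. As 0 <= M and m <= M, these two disjoint events are the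
    subtracted ones. *)
Lemma limit_joint_lawP (R : realType) (d : measure_display)
    (T : measurableType d) (P : probability T R) (X Y : {RV P >-> R}) :
  limit_joint_law P X Y
    P (fun t => Wval (X t) (Y t)) (fun t => Mval (X t) (Y t)).
Proof.
move=> x y.
have [mX mY] : measurable_fun setT X /\ measurable_fun setT Y by [].
have mM := measurable_Mval mX mY; have mm := measurable_mval mX mY.
have mW := measurable_Wval mX mY.
have mI : measurable_fun setT (fun t => `|X t| <= 2 * `|Y t|).
  apply: measurable_fun_ler; first exact: measurableT_comp.
  by apply: measurable_funM => //; exact: measurableT_comp.
have mset (p : T -> bool) : measurable_fun setT p -> measurable [set t | p t].
  by move=> mp; rewrite -[X in measurable X]setTI; exact: mp.
set C := [set t | _ <= y]; set B1 := [set t | x < 0 /\ _].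
set B2 := [set t | x < mval _ _ /\ _].
have mC : measurable C by apply: mset; exact: measurable_fun_ler.
have mB1 : measurable B1.
  rewrite [B1](_ : _ = [set t | [&& x < 0, 0 <= Mval (X t) (Y t),
      Mval (X t) (Y t) <= y & `|X t| <= 2 * `|Y t| ]]).
    apply: mset; do !apply: measurable_and => //; exact: measurable_fun_ler.
  apply/seteqP; split => t; last by move=> /and4P[].
  by move=> [x0 [M0 [My I]]]; apply/and4P; split.
have mB2 : measurable B2.
  rewrite [B2](_ : _ = [set t | [&& x < mval (X t) (Y t),
      mval (X t) (Y t) <= Mval (X t) (Y t),
      Mval (X t) (Y t) <= y & ~~ (`|X t| <= 2 * `|Y t|) ]]).
    apply: mset; do !apply: measurable_and => //; try exact: measurable_fun_ler.
      exact: measurable_fun_ltr.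
    exact: measurable_neg.
  apply/seteqP; split => t; last by move=> /and4P[? ? ? /negP ?].
  by move=> [xm [mM' [My /negP I]]]; apply/and4P; split.
have -> : [set t | Wval (X t) (Y t) <= x /\ Mval (X t) (Y t) <= y] =
    C `\` B1 `\` B2.
  apply/seteqP; split => t; rewrite /C /B1 /B2 /Wval /=.
    case: ifP => [I|/negP I] [Wx My]; (split; first split) => // -[].
    - by rewrite ltNge Wx.
    - by move=> _ [_ [_]].
    - by move=> _ [_ [_]].
    - by rewrite ltNge Wx.
  move=> [[My nB1] nB2]; split => //; case: ifPn => [I|/negP I]; rewrite leNgt.
    apply/negP => x0; apply: nB1; split => //; split => //.
    exact: le_trans (Wval_ge0 _ _) (Wval_le_Mval _ _).
  apply/negP => xm; apply: nB2; split => //; split => //; exact: mval_le_Mval.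
have CB : (C `\` B1) `&` B2 = B2.
  apply/setIidr => t [_ [_ [My nI]]]; split => // -[_ [_ [_ I]]]; exact: nI.
have CB1 : C `&` B1 = B1 by apply/setIidr => t [_ [_ [My _]]].
have fin A : measurable A -> (P A < +oo)%E.
  by move=> mA; rewrite -ge0_fin_numE // fin_num_measure.
have mCB := measurableD mC mB1.
by rewrite measureD ?fin // CB measureD ?fin // CB1.
Qed.

(** The closed lower-left quadrants are stable under intersection, cover the
    plane by countably many of them, and generate the product sigma-algebra:
    a half-plane p.1 <= x or p.2 <= x is a countable union of quadrants. Two
    probabilities that agree on them are therefore equal. *)
Lemma joint_law_unique (R : realType) (d : measure_display)
    (T : measurableType d) (P : probability T R)
    (d' : measure_display) (T' : measurableType d') (P' : probability T' R)
    (W V : T -> R) (W' V' : T' -> R) :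
  measurable_fun setT W -> measurable_fun setT V ->
  measurable_fun setT W' -> measurable_fun setT V' ->
  (forall x y, P [set t | W t <= x /\ V t <= y] =
               P' [set t | W' t <= x /\ V' t <= y]) ->
  forall A : set (R * R), measurable A ->
    P [set t | A (W t, V t)] = P' [set t | A (W' t, V' t)].
Proof.
move=> mW mV mW' mV' cdfE A mA.
pose quad (x y : R) : set (R * R) := [set p | p.1 <= x /\ p.2 <= y].
pose G : set (set (R * R)) := [set B | exists x y, B = quad x y].
have quadX x y : quad x y = `]-oo, x] `*` `]-oo, y].
  by apply/seteqP; split => p; rewrite /quad /= !in_itv.
have mG : measurable = <<s G >>.
  apply/seteqP; split => B; last first.
    apply: smallest_sub; first exact: sigma_algebra_measurable.
    move=> _ [x [y ->]]; rewrite quadX.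
    by apply: measurableX; exact: measurable_itv.
  have mfst : measurable_fun setT (fst : g_sigma_algebraType G -> R).
    apply: (measurability _ (RGenOInfty.measurableE R)).
    move=> _ [_ [x ->] <-]; rewrite setTI.
    have -> : fst @^-1` `]x, +oo[ = ~` \bigcup_k quad x k%:R.
      apply/seteqP; split => p /=; rewrite in_itv /= andbT.
        by move=> xp [k _ [/=]]; rewrite leNgt xp.
      rewrite ltNge => npx; apply/negP => px; apply: npx.
      exists (Num.truncn `|p.2|).+1 => //; split => //=.
      by rewrite (le_trans (ler_norm _)) // ltW // truncnS_gt.
    apply: measurableC; apply: bigcupT_measurable => k.
    by apply: sub_sigma_algebra; exists x, k%:R.
  have msnd : measurable_fun setT (snd : g_sigma_algebraType G -> R).
    apply: (measurability _ (RGenOInfty.measurableE R)).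
    move=> _ [_ [x ->] <-]; rewrite setTI.
    have -> : snd @^-1` `]x, +oo[ = ~` \bigcup_k quad k%:R x.
      apply/seteqP; split => p /=; rewrite in_itv /= andbT.
        by move=> xp [k _ [/=]] _; rewrite leNgt xp.
      rewrite ltNge => npx; apply/negP => px; apply: npx.
      exists (Num.truncn `|p.1|).+1 => //; split => //=.
      by rewrite (le_trans (ler_norm _)) // ltW // truncnS_gt.
    apply: measurableC; apply: bigcupT_measurable => k.
    by apply: sub_sigma_algebra; exists k%:R, x.
  have mid : measurable_fun setT (id : g_sigma_algebraType G -> (R * R)%type).
    by apply/measurable_fun_pairP.
  by move=> /(mid measurableT); rewrite setTI.
pose U : {RV P >-> (R * R)%type} := HB.pack (fun t => (W t, V t))
  (isMeasurableFun.Build _ _ _ _ _ (measurable_fun_pair mW mV)).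
pose U' : {RV P' >-> (R * R)%type} := HB.pack (fun t => (W' t, V' t))
  (isMeasurableFun.Build _ _ _ _ _ (measurable_fun_pair mW' mV')).
suff : distribution P U A = distribution P' U' A by [].
apply: (measure_unique G (fun k => quad k%:R k%:R)) => //.
- move=> _ _ [x [y ->]] [x' [y' ->]]; exists (Num.min x x'), (Num.min y y').
  apply/seteqP; split => p; rewrite /quad /= !le_min.
    by move=> [[-> ->] [-> ->]].
  by move=> [/andP[-> ->] /andP[-> ->]].
- by move=> k; exists k%:R, k%:R.
- apply/seteqP; split => // p _.
  exists (Num.truncn (`|p.1| + `|p.2|)).+1 => //.
  have := truncnS_gt (`|p.1| + `|p.2|) => /ltW lek.
  split => /=; apply: le_trans lek; rewrite (le_trans (ler_norm _)) //.
    by rewrite lerDl.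
  by rewrite lerDr.
- by move=> _ [x [y ->]]; exact: cdfE.
- move=> k; rewrite -ge0_fin_numE // fin_num_measure //= mG.
  by apply: sub_sigma_algebra; exists k%:R, k%:R.
Qed.

(** * Integrals of test functions *)

Lemma measurable_ext_half_line (R : realType) : measurable (@ext_half_line R).
Proof.
have -> : @ext_half_line R = `[1%E, +oo%E]%classic.
  by apply/seteqP; split => x; rewrite /ext_half_line /= in_itv /= leey andbT.
exact: emeasurable_itv.
Qed.

(** Off the point +oo this reduces, through EFin, to the measurability of
    continuous functions on the real half-line [1, +oo[. *)
Lemma continuous_half_line_measurable (R : realType) (f : \bar R -> R) :
  {within @ext_half_line R, continuous f} ->
  measurable_fun (@ext_half_line R) f.
Proof.
move=> cf; have mS := measurable_ext_half_line R.
have splitS : @ext_half_line R = EFin @` `[1, +oo[ `|` [set +oo%E].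
  apply/seteqP; split => [[x|//|//]|]; rewrite /ext_half_line /=.
  - by rewrite lee_fin => x1; left; exists x; rewrite //= in_itv /= x1.
  - by right.
  move=> y [[x /=]|->]; last exact: leey.
  by rewrite in_itv /= andbT => x1 <-; rewrite lee_fin.
have mfin : measurable (EFin @` `[(1 : R), +oo[).
  by apply: measurable_image_EFin; exact: measurable_itv.
rewrite splitS; apply/measurable_funU => //; split;
  last exact: measurable_fun_set1.
apply: (eq_measurable_fun ((f \o EFin) \o fine)).
  by move=> _ /set_mem[x _ <-].
pose I : set R := [set` `[1, +oo[]; apply: (measurable_comp (F := I)).
- exact: measurable_itv.
- by move=> _ [_ [x x1 <-] <-].
- apply: subspace_continuous_measurable_fun; first exact: measurable_itv.
  apply/subspace_continuousP => x; rewrite /I /= in_itv /= andbT => x1.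
  have Sx : @ext_half_line R x%:E by rewrite /ext_half_line /= lee_fin.
  move/subspace_continuousP/(_ _ Sx): cf => cf.
  apply: cvg_comp cf => B; rewrite /within /= => nearB.
  have nearEB : nbhs x (fun z => ext_half_line z%:E -> B z%:E).
    have /(_ _ nearB) // : EFin z @[z --> x] --> x%:E.
    by apply/cvg_EFin; [exact: nearW|exact: cvg_id].
  change (nbhs x (fun z => I z -> B z%:E)).
  apply: filterS nearEB => z; rewrite /I /= in_itv /= andbT => zB z1; apply: zB.
  by rewrite /ext_half_line /= lee_fin.
- exact: fine_measurable.
Qed.

(** Both sides are integrals over S against the image measure on the extended
    line; f is replaced by 0 outside S, where nothing is known about it. *)
Lemma integral_same_law (R : realType) (d : measure_display)
    (T : measurableType d) (P : probability T R)
    (d' : measure_display) (T' : measurableType d') (P' : probability T' R)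
    (S : set (\bar R)) (Z : T -> \bar R) (Z' : T' -> \bar R) (f : \bar R -> R) :
  measurable_fun setT Z -> measurable_fun setT Z' ->
  (forall A, measurable A -> P (Z @^-1` A) = P' (Z' @^-1` A)) ->
  measurable S -> measurable_fun S f ->
  (exists C : R, forall x, S x -> `|f x| <= C) ->
  (\int[P]_(t in Z @^-1` S) (f (Z t))%:E =
   \int[P']_(t in Z' @^-1` S) (f (Z' t))%:E)%E.
Proof.
move=> mZ mZ' lawE mS mf [C fC]; pose g := f \_ S.
have mg : measurable_fun setT g by apply/(measurable_restrictT f mS).
have gf x : S x -> g x = f x by move=> Sx; rewrite /g patchT // inE.
have transfer d0 (T0 : measurableType d0) (P0 : probability T0 R)
    (Z0 : {RV P0 >-> \bar R}) :
  (\int[P0]_(t in Z0 @^-1` S) (f (Z0 t))%:E =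
   \int[distribution P0 Z0]_(z in S) (g z)%:E)%E.
  have mZS : measurable (Z0 @^-1` S).
    by rewrite -[X in measurable X]setTI; exact: measurable_funP.
  rewrite integral_pushforward //.
  - by apply: eq_integral => t /set_mem St; rewrite /= gf.
  - exact/measurable_EFinP.
  - apply: measurable_bounded_integrable => //.
    + by rewrite -ge0_fin_numE // fin_num_measure.
    + by apply: measurable_funTS; exact: measurableT_comp.
    + exists C; split; first exact: num_real.
      by move=> M CM t St; rewrite /= gf // (le_trans (fC _ St)) // ltW.
pose U : {RV P >-> \bar R} := HB.pack Z (isMeasurableFun.Build _ _ _ _ _ mZ).
pose U' : {RV P' >-> \bar R} :=
  HB.pack Z' (isMeasurableFun.Build _ _ _ _ _ mZ').
rewrite (transfer _ _ _ U) (transfer _ _ _ U').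
by apply: eq_measure_integral => A mA _; exact: lawE.
Qed.

(** The constant bounding f on the half-line is integrable, as P is finite, so
    dominated convergence applies to the sequence f (Z_ n). *)
Lemma cvg_integral_half_line (R : realType) (d : measure_display)
    (T : measurableType d) (P : probability T R)
    (Z_ : nat -> T -> \bar R) (Z : T -> \bar R) (f : \bar R -> R) :
  (forall n, measurable_fun setT (Z_ n)) -> measurable_fun setT Z ->
  (forall n t, ext_half_line (Z_ n t)) -> (forall t, ext_half_line (Z t)) ->
  (forall t, Z_ n t @[n --> \oo] --> Z t) ->
  {within @ext_half_line R, continuous f} ->
  (exists C : R, forall x, ext_half_line x -> `|f x| <= C) ->
  (\int[P]_(t in Z_ n @^-1` @ext_half_line R) (f (Z_ n t))%:E)%E @[n --> \oo]
    --> (\int[P]_(t in Z @^-1` @ext_half_line R) (f (Z t))%:E)%E.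
Proof.
move=> mZ_ mZ SZ_ SZ cvgZ cf [C fC].
have mf := continuous_half_line_measurable cf.
have mS := measurable_ext_half_line R.
have preT (Y : T -> \bar R) : (forall t, ext_half_line (Y t)) ->
    Y @^-1` @ext_half_line R = setT.
  by move=> SY; apply/seteqP; split => t _ /=.
have mfZ (Y : T -> \bar R) : measurable_fun setT Y ->
    (forall t, ext_half_line (Y t)) ->
    measurable_fun setT (fun t => (f (Y t))%:E).
  move=> mY SY; apply/measurable_EFinP.
  by apply: (measurable_comp (F := @ext_half_line R)) => // _ [t _ <-].
rewrite preT //; under eq_fun do rewrite preT //.
have [] := @dominated_convergence _ _ _ P setT measurableT
  (fun n t => (f (Z_ n t))%:E) (fun t => (f (Z t))%:E) (cst C%:E)
  _ _ _ _ _ => //.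
- by move=> n; exact: mfZ.
- exact: mfZ.
- apply: aeW => t _; apply/cvg_EFin; first exact: nearW.
  move/subspace_continuousP/(_ _ (SZ t)): cf; apply: cvg_comp => B nearB.
  have nearZ : \forall n \near \oo, ext_half_line (Z_ n t) -> B (Z_ n t) :=
    cvgZ t _ nearB.
  change (\forall n \near \oo, B (Z_ n t)).
  by apply: filterS nearZ => n; apply; exact: SZ_.
- by apply: finite_measure_integrable_cst.
- by apply: aeW => t n _; rewrite lee_fin fC.
Qed.

(** * Convergence in distribution *)

Theorem mainTheorem2 (R : realType) (d : measure_display)
    (T : measurableType d) (P : probability T R) (X Y : {RV P >-> R}) :
  (exists (d' : measure_display) (T' : measurableType d')
     (P' : probability T' R) (W V : {RV P' >-> R}),
     limit_joint_law P X Y P' W V) /\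
  (forall (d' : measure_display) (T' : measurableType d')
     (P' : probability T' R) (W V : {RV P' >-> R}),
     limit_joint_law P X Y P' W V ->
     converges_in_distribution (@ext_half_line R)
       P (fun n t => condition_number (toeplitz3 n.+1 (X t) (Y t)))
       P' (fun t => ext_quotient (V t) (W t))).
Proof.
have [mX mY] : measurable_fun setT X /\ measurable_fun setT Y by [].
pose W0 t := Wval (X t) (Y t); pose V0 t := Mval (X t) (Y t).
have mW0 : measurable_fun setT W0 by exact: measurable_Wval.
have mV0 : measurable_fun setT V0 by exact: measurable_Mval.
have law0 : limit_joint_law P X Y P W0 V0 by exact: limit_joint_lawP.
split.
  pose W0RV : {RV P >-> R} := HB.pack W0 (isMeasurableFun.Build _ _ _ _ _ mW0).
  pose V0RV : {RV P >-> R} := HB.pack V0 (isMeasurableFun.Build _ _ _ _ _ mV0).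
  by exists d, T, P, W0RV, V0RV.
move=> d' T' P' W V lawWV.
have [mW mV] : measurable_fun setT W /\ measurable_fun setT V by [].
pose Z0 t := ext_quotient (V0 t) (W0 t); pose Z t := ext_quotient (V t) (W t).
have mZ0 : measurable_fun setT Z0 by exact: measurable_ext_quotient.
have mZ : measurable_fun setT Z by exact: measurable_ext_quotient.
have SZ0 t : ext_half_line (Z0 t).
  by apply: ext_quotient_ge1; rewrite Wval_ge0 Wval_le_Mval.
have Sn n t : ext_half_line (condition_number (toeplitz3 n.+1 (X t) (Y t))).
  by apply: ext_quotient_ge1; rewrite sigma_min_ge0 sigma_min_le_max.
have mn n : measurable_fun setT
    (fun t => condition_number (toeplitz3 n.+1 (X t) (Y t))).
  by have [] := measurable_sigma n mX mY; exact: measurable_ext_quotient.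
have lawZ A : measurable A -> P (Z0 @^-1` A) = P' (Z @^-1` A).
  move=> mA; pose q (p : R * R) := ext_quotient p.2 p.1.
  have mq : measurable_fun setT q by apply: measurable_ext_quotient.
  apply: (joint_law_unique mW0 mV0 mW mV _ (A := q @^-1` A)).
    by move=> x y; rewrite law0 lawWV.
  by rewrite -[X in measurable X]setTI; exact: mq.
have mS := measurable_ext_half_line R.
split.
- by move=> n; split => //; exact: aeW.
- split=> //; exists (Z @^-1` ~` (@ext_half_line R)); split => //.
  + by rewrite -[X in measurable X]setTI; apply: mZ => //; exact: measurableC.
  + rewrite -lawZ; last exact: measurableC.
    rewrite (_ : _ @^-1` _ = set0) ?measure0 //.
    by apply/seteqP; split => t //=; apply.
- move=> f cf fC.
  have mf := continuous_half_line_measurable cf.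
  rewrite -(integral_same_law mZ0 mZ lawZ mS mf fC).
  by apply: cvg_integral_half_line => // t; exact: cvg_condition_number.
Qed.
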